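(* For every odd integer $N\ge 5$, $$t_N^{(N+1)}(N^2)\ \ge\ 3N+1 .$$ That is, there is a set of $N^2$ points in the plane, with no line containing more than $N$ of them, such that at least $3N+1$ lines contain exactly $N$ of the points.
   Context: All points and lines are in the real plane $\mathbf{R}^2$. For a finite set $S$ of points in the plane, $t_k(S)$ denotes the number of lines meeting $S$ in exactly $k$ points. For $r>k$, $t_k^{(r)}(n)$ denotes the maximum of $t_k(S)$ over all sets $S$ of $n$ points in the plane such that no line contains $r$ or more points of $S$. *)

(* Defs.v *)
From HB Require Import structures.
From mathcomp Require Import all_boot all_order all_algebra.
From mathcomp Require Import finmap.
From mathcomp Require Import all_classical all_reals.

Set Implicit Arguments.
Unset Strict Implicit.
Unset Printing Implicit Defensive.

Local Open Scope classical_set_scope.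
Local Open Scope fset_scope.
Local Open Scope ring_scope.

Definition line (R : realType) (a b c : R) : set (R * R) :=
  [set p | a * p.1 + b * p.2 = c].

(* A line is identified with its set of points, so that proportional equations
   are not counted as different lines. *)
Definition is_line (R : realType) (L : set (R * R)) : Prop :=
  exists a b c : R, (a, b) <> (0, 0) /\ L = line a b c.

Definition incidence (R : realType) (S : {fset R * R}) (L : set (R * R)) : nat :=
  #|` [fset p in S | p \in L]|.

Definition lines_meeting (R : realType) (k : nat) (S : {fset R * R}) :
    set (set (R * R)) :=
  [set L | is_line L /\ incidence S L = k].

(* t_k(S).  For k >= 2 there are finitely many such lines, two points
   determining a line.  For k <= 1 there may be infinitely many, and [fset_set]
   then returns the empty set; only k >= 2 is meaningful. *)
Definition tk (R : realType) (k : nat) (S : {fset R * R}) : nat :=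
  #|` fset_set (lines_meeting k S)|.

Definition no_rich_line (R : realType) (r : nat) (S : {fset R * R}) : Prop :=
  forall L : set (R * R), is_line L -> (incidence S L < r)%N.

Definition is_tmax (R : realType) (k r n m : nat) : Prop :=
  (exists S : {fset R * R}, [/\ #|` S| = n, no_rich_line r S & tk k S = m]) /\
  (forall S : {fset R * R}, #|` S| = n -> no_rich_line r S -> (tk k S <= m)%N).

(* t_k^(r)(n).  For 2 <= k < r the maximum exists: sets in general position are
   admissible and tk k S <= 'C(n, 2).  The default 0 is then never used. *)
Definition tmax (R : realType) (k r n : nat) : nat :=
  xget 0%N [set m | is_tmax R k r n m].

(* Main.v *)
Require Import Defs.
From mathcomp Require Import all_boot all_order all_algebra.
From mathcomp Require Import finmap.
From mathcomp Require Import all_classical all_reals.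
From mathcomp Require Import trigo.
From mathcomp Require Import ring lra zify.

(** The configuration is the projective dual of a regular 2N-gon inscribed in
    a circle.  Colour the vertices of the polygon alternately even and odd.
    The N^2 chords joining an even vertex to an odd one fall into N parallel
    classes of N chords each, because the direction of a chord depends only on
    the sum of the two arguments; N chords pass through each vertex; and, as N
    is odd, opposite vertices have different colours, so that N of the chords
    are diameters and meet at the center.  This gives
    2N (vertices) + N (points at infinity) + 1 (center) = 3N + 1
    points, each on N of the N^2 chords.  Duality turns the chords into N^2
    points and these points into 3N + 1 lines.

    The line at infinity of the dual plane has to be the dual of a point on no
    chord: a point at infinity which is not the direction of a chord is taken.
    In suitable coordinates the chord with indices a, b modulo N then becomes
    the point ( tan(A + B), sin(A - B) / cos(A + B) ), with A = a pi / N and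
    B = b pi / N; the denominator does not vanish because N is odd.  All
    incidences between these points and the 3N + 1 lines reduce, by sum-to-product
    formulas, to congruences modulo N between indices
    ([cfg_point_rich_line]), and the counting takes place in 'I_N * 'I_N.

    No line L carries more than N of the points
    ([incidence_configuration_le]): if the first index is not injective on the
    points of L, then L is one of the lines on which this index is constant,
    and there the second index is injective.

    For the bound on the maximum, two points determine a line, so the number
    of k-rich lines of an n-point set is at most n^2 when k >= 2; the maximum
    is therefore attained, and it dominates every admissible set
    ([tk_le_tmax]). *)

Set Implicit Arguments.
Unset Strict Implicit.
Unset Printing Implicit Defensive.

Import Order.TTheory GRing.Theory Num.Theory.

(** * Rich lines of a finite set of points *)

Section Lines.
Local Open Scope ring_scope.
Variable R : realType.
Implicit Types (p q : R * R) (L : set (R * R)) (S : {fset R * R}).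

Definition line_through p q : set (R * R) :=
  line (q.2 - p.2) (p.1 - q.1) ((q.2 - p.2) * p.1 + (p.1 - q.1) * p.2).

Lemma is_line_through L p q :
  is_line L -> p != q -> p \in L -> q \in L -> L = line_through p q.
Proof.
move=> [a [b [c [ab0 ->]]]] pq; rewrite !inE /line /= => pL qL.
(* The normal (a, b) is orthogonal to q - p, hence proportional to the normal
   used in line_through. *)
have [l l0 [aE bE]] :
    exists2 l, l != 0 & a = l * (q.2 - p.2) /\ b = l * (p.1 - q.1).
  have abE : a * (q.1 - p.1) = b * (p.2 - q.2).
    by move: pL qL => <-; rewrite !mulrBr => /eqP; lra.
  have [p1q1|p1q1] := eqVneq p.1 q.1.
    have d0 : q.2 - p.2 != 0.
      rewrite subr_eq0; apply: contra pq => /eqP p2q2.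
      by case: p q p1q1 p2q2 {pL qL abE} => [? ?] [? ?] /= -> ->.
    have b0 : b = 0.
      apply/eqP; move/eqP: abE; rewrite p1q1 subrr mulr0 eq_sym mulf_eq0.
      by rewrite -(opprB q.2) oppr_eq0 (negPf d0) orbF.
    exists (a / (q.2 - p.2)); last by rewrite divfK // p1q1 subrr mulr0.
    rewrite mulf_neq0 ?invr_eq0 //; apply/eqP => a0.
    by apply: ab0; rewrite a0 b0.
  have d0 : p.1 - q.1 != 0 by rewrite subr_eq0.
  exists (b / (p.1 - q.1)).
    rewrite mulf_neq0 ?invr_eq0 //; apply/eqP => b0; apply: ab0.
    congr pair => //; apply/eqP; move/eqP: abE.
    by rewrite b0 mul0r mulf_eq0 -(opprB p.1) oppr_eq0 (negPf d0) orbF.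
  split; last by rewrite divfK.
  apply: (mulIf d0); rewrite mulrAC divfK //; lra.
apply/seteqP; split=> r /=; rewrite -pL aE bE => E.
  apply: (mulfI l0); lra.
move/(congr1 ( *%R l)) : E; lra.
Qed.

Lemma incidence_gt1 S L : (1 < incidence S L)%N ->
  exists p q, [/\ p \in S, q \in S, p != q, p \in L & q \in L].
Proof.
rewrite /incidence; set F := (X in #|` X|) => F1.
have [p pF] : exists p, p \in F.
  by apply/fset0Pn; rewrite -cardfs_gt0 (ltn_trans _ F1).
have [q] : exists q, q \in (F `\ p)%fset.
  by apply/fset0Pn; rewrite -cardfs_gt0; move: F1; rewrite (cardfsD1 p) pF.
rewrite in_fsetD1 => /andP[qp qF].
move: pF qF; rewrite !in_fset /= => /andP[pS pL] /andP[qS qL].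
by exists p, q; rewrite eq_sym.
Qed.

Definition joining_lines S : {fset set (R * R)} :=
  [fset line_through (val u.1) (val u.2) | u : S * S in predT]%fset.

Lemma lines_meeting_joining k S L : (1 < k)%N ->
  lines_meeting k S L -> L \in joining_lines S.
Proof.
move=> k1 [lL kL]; move: k1; rewrite -kL => /incidence_gt1.
move=> [p [q [pS qS pq pL qL]]].
by apply/imfsetP; exists ([` pS]%fset, [` qS]%fset) => //=; exact: is_line_through.
Qed.

(** Needed because the cardinal of [fset_set] is meaningful only on finite
    sets. *)
Lemma finite_lines_meeting k S : (1 < k)%N -> finite_set (lines_meeting k S).
Proof.
move=> k1; apply: (sub_finite_set _ (finite_fset (joining_lines S))).
by move=> L /(lines_meeting_joining k1).
Qed.

Lemma tk_le k S : (1 < k)%N -> (tk k S <= #|` S| * #|` S|)%N.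
Proof.
move=> k1; apply: (@leq_trans #|` joining_lines S|).
  apply: fsubset_leq_card; apply/fsubsetP => L.
  rewrite in_fset_set; last exact: finite_lines_meeting.
  by rewrite inE => /(lines_meeting_joining k1).
apply: leq_trans (leq_imfset_card _ _ _) _.
by rewrite -cardE card_prod -cardfE.
Qed.

(** The set of attained values is nonempty, as it contains tk k S, and bounded
    by [tk_le]; hence it has a largest element, and [tmax] takes this value
    instead of its default. *)
Lemma tk_le_tmax k r n S : (1 < k)%N -> #|` S| = n -> no_rich_line r S ->
  (tk k S <= tmax R k r n)%N.
Proof.
move=> k1 Sn Sr.
pose attained m := `[< exists S' : {fset R * R},
  [/\ #|` S'| = n, no_rich_line r S' & tk k S' = m] >].
have ex_att : exists m, attained m by exists (tk k S); apply/asboolP; exists S.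
have att_le m : attained m -> (m <= n * n)%N.
  by move=> /asboolP[S' [<- _ <-]]; exact: tk_le.
have [m /asboolP m_att m_max] := ex_maxnP ex_att att_le.
have : is_tmax R k r n (tmax R k r n).
  apply: (@xgetPex _ 0%N (is_tmax R k r n)); exists m; split=> // S' S'n S'r.
  by apply: m_max; apply/asboolP; exists S'.
by case=> _; apply.
Qed.

Lemma incidence_image (T : finType) (P : T -> R * R) L : injective P ->
  incidence [fset P x | x in T]%fset L = #|[set x | P x \in L]%SET|.
Proof.
move=> P_inj; rewrite /incidence.
have -> : [fset p in [fset P x | x in T]%fset | p \in L]%fset =
          [fset P x | x in [set x | P x \in L]%SET]%fset.
  apply/fsetP => p; rewrite in_fset /=; apply/andP/imfsetP => /=.
    by move=> [/imfsetP[x /= _ ->] PxL]; exists x; rewrite ?finset.in_set.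
  move=> [x]; rewrite finset.in_set => xL ->; split=> //.
  by apply/imfsetP; exists x.
by rewrite card_imfset //= -cardE.
Qed.

End Lines.

(** * The dual of the regular 2N-gon *)

Section Construction.
Local Open Scope ring_scope.
Variables (R : realType) (N : nat).
Hypotheses (N_odd : odd N) (N_ge3 : (3 <= N)%N).

Definition angle (z : int) : R := z%:~R * (pi / N%:R).

Lemma angleD x y : angle (x + y) = angle x + angle y.
Proof. by rewrite /angle intrD mulrDl. Qed.

Lemma angleN x : angle (- x) = - angle x.
Proof. by rewrite /angle intrN mulNr. Qed.

Let N_gt0 : (0 < N)%N. Proof. exact: leq_trans N_ge3. Qed.
Let NR_neq0 : N%:R != 0 :> R. Proof. by rewrite pnatr_eq0 -lt0n. Qed.

(** Only the remainder of z modulo N matters up to sign, and sin is positive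
    on the open interval from 0 to pi. *)
Lemma sin_angle_eq0 z : (sin (angle z) == 0) = (N %| z)%Z.
Proof.
wlog [n ->] : z / exists n : nat, z = n.
  move=> wl; case: z => n; first by apply: wl; exists n.
  by rewrite NegzE angleN sinN oppr_eq0 dvdzE abszN; apply: wl; exists n.+1.
have -> : angle n = angle (n %% N)%N + pi *+ (n %/ N).
  rewrite {1}(divn_eq n N) PoszD PoszM addrC angleD; congr (_ + _).
  by rewrite /angle intrM -!pmulrn -mulrA [X in _ * X]mulrCA divff // mulr1 mulr_natl.
rewrite (alternatingn (@sinDpi R)) mulf_eq0 signr_eq0 /= dvdzE /dvdn /=.
have := ltn_pmod n N_gt0.
case: (n %% N)%N => [|r] r_lt; first by rewrite /angle mul0r sin0 !eqxx.
apply/gt_eqF/sin_gt0_pi.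
rewrite /angle mulrCA; apply/andP; split.
  by rewrite mulr_gt0 ?pi_gt0 // divr_gt0 ?ltr0n.
by rewrite gtr_pMr ?pi_gt0 // ltr_pdivrMr ?ltr0n // mul1r ltr_nat.
Qed.

(** If cos x = 0 then sin (2 x) = 0, so N divides 2 z, hence z since N is
    odd; but then sin x vanishes together with cos x. *)
Lemma cos_angle_neq0 z : cos (angle z) != 0.
Proof.
apply/eqP => cz.
have : (N %| z *+ 2)%Z.
  by rewrite -sin_angle_eq0 mulr2n angleD sinD cz mulr0 mul0r addr0.
rewrite -mulr_natr Gauss_dvdzl; last by rewrite coprimezE natz coprimen2.
rewrite -sin_angle_eq0 => /eqP sz.
by have := cos2Dsin2 (angle z); rewrite cz sz !expr0n addr0 => /eqP; rewrite eq_sym oner_eq0.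
Qed.

(** The difference of the two sides is 2 cos(u) sin(v), and the cosine does
    not vanish.  The incidences with the lines dual to the vertices reduce to
    this formula. *)
Lemma sin_angle_eq u v :
  (sin (angle (u + v)) == sin (angle (u - v))) = (N %| v)%Z.
Proof.
rewrite -sin_angle_eq0 !angleD angleN sinD sinB.
rewrite -subr_eq0.
have -> : forall x y : R, x + y - (x - y) = 2 * y by move=> x y; ring.
by rewrite !mulf_eq0 pnatr_eq0 (negPf (cos_angle_neq0 u)).
Qed.

(** The chord of the unit circle whose end points have arguments s + d and
    s - d has equation x cos s + y sin s = cos d.  Here
    s = angle (a + b) and d = angle (a - b) - pi / 2, and the homogeneous
    coordinates (cos s : sin s : cos d) are divided by the first one. *)
Definition chord_dual (a b : int) : R * R :=
  (sin (angle (a + b)) / cos (angle (a + b)),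
   sin (angle (a - b)) / cos (angle (a + b))).

(** Duals of the two colour classes of vertices, of the points at infinity of
    the chords, and of the center of the circle. *)
Definition even_line (c : int) := line (cos (angle (c + c))) 1 (sin (angle (c + c))).
Definition odd_line (c : int) := line (- cos (angle (c + c))) 1 (- sin (angle (c + c))).
Definition direction_line (k : int) := line (cos (angle k)) 0 (sin (angle k)).
Definition center_line : set (R * R) := line 0 1 0.

Lemma chord_dual_line u v w a b : (chord_dual a b \in line u v w) =
  (u * sin (angle (a + b)) + v * sin (angle (a - b)) == w * cos (angle (a + b))).
Proof.
have c0 := cos_angle_neq0 (a + b).
apply/idP/eqP; rewrite inE /line /= => E.
  by rewrite -E mulrDl !mulrA !divfK.
by apply: (mulIf c0); rewrite -E mulrDl !mulrA !divfK.
Qed.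

Lemma chord_dual_even a b c : (chord_dual a b \in even_line c) = (N %| c - a)%Z.
Proof.
rewrite -(sin_angle_eq (c - b)) chord_dual_line mul1r.
have -> : c - b - (c - a) = a - b by ring.
have -> : c - b + (c - a) = (c + c) - (a + b) by ring.
rewrite [angle (c + c - _)]angleD angleN sinB.
by rewrite -subr_eq0 -[RHS]subr_eq0 -[RHS]oppr_eq0; congr (_ == _); ring.
Qed.

Lemma chord_dual_odd a b c : (chord_dual a b \in odd_line c) = (N %| c - b)%Z.
Proof.
rewrite -(sin_angle_eq (a - c)) chord_dual_line mul1r.
have -> : a - c + (c - b) = a - b by ring.
have -> : a - c - (c - b) = (a + b) - (c + c) by ring.
rewrite [angle (a + b - (c + c))]angleD angleN sinB.
by rewrite -subr_eq0 -[RHS]subr_eq0; congr (_ == _); ring.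
Qed.

Lemma chord_dual_direction a b k :
  (chord_dual a b \in direction_line k) = (N %| a + b - k)%Z.
Proof.
rewrite -sin_angle_eq0 chord_dual_line mul0r addr0 [angle (a + b - k)]angleD angleN sinB.
by rewrite -subr_eq0; congr (_ == _); ring.
Qed.

Lemma chord_dual_center a b : (chord_dual a b \in center_line) = (N %| a - b)%Z.
Proof. by rewrite -sin_angle_eq0 chord_dual_line !mul0r add0r mul1r. Qed.

Lemma dvdz_subz_ord (i j : 'I_N) : (N %| (i : int) - (j : int))%Z = (i == j).
Proof.
rewrite -eqz_mod_dvd !modz_nat !modn_small ?ltn_ord //.
Qed.

Notation index := ('I_N * 'I_N)%type.

Definition cfg_point (x : index) : R * R := chord_dual x.1 x.2.

Definition rich_index := ('I_N + 'I_N + 'I_N + unit)%type.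

Definition rich_line (t : rich_index) : set (R * R) :=
  match t with
  | inl (inl (inl c)) => even_line c
  | inl (inl (inr c)) => odd_line c
  | inl (inr k) => direction_line k
  | inr _ => center_line
  end.

(** The trace of a rich line on the index square. *)
Definition index_line (t : rich_index) : {set index} :=
  match t with
  | inl (inl (inl c)) => [set x | x.1 == c]
  | inl (inl (inr c)) => [set x | x.2 == c]
  | inl (inr k) => [set x : index | (x.1 + x.2 == k %[mod N])%N]
  | inr _ => [set x | x.1 == x.2]
  end%SET.

Lemma cfg_point_rich_line x t : (cfg_point x \in rich_line t) = (x \in index_line t).
Proof.
case: t => [[[c|c]|k]|[]]; rewrite inE /cfg_point /rich_line.
- by rewrite chord_dual_even dvdz_subz_ord eq_sym.
- by rewrite chord_dual_odd dvdz_subz_ord eq_sym.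
- by rewrite chord_dual_direction -eqz_mod_dvd -PoszD !modz_nat.
- by rewrite chord_dual_center dvdz_subz_ord.
Qed.

(** The two lines dual to the end points of a chord recover its indices. *)
Lemma cfg_point_inj : injective cfg_point.
Proof.
move=> [a b] [a' b'] E; congr pair; apply/eqP.
  have := cfg_point_rich_line (a, b) (inl (inl (inl a'))).
  by rewrite E cfg_point_rich_line !inE eqxx.
have := cfg_point_rich_line (a, b) (inl (inl (inr b'))).
by rewrite E cfg_point_rich_line !inE eqxx.
Qed.

Lemma is_line_rich t : is_line (rich_line t).
Proof.
have lineP (u v w : R) : (u != 0) || (v != 0) -> is_line (line u v w).
  by move=> uv; exists u, v, w; split=> // -[u0 v0]; rewrite u0 v0 eqxx in uv.
by case: t => [[[c|c]|k]|[]]; apply: lineP; rewrite ?cos_angle_neq0 ?oner_eq0 ?orbT.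
Qed.

Definition ord_of (n : nat) : 'I_N := Ordinal (ltn_pmod n N_gt0).

(** Each class contains the graph of a function of one of the two indices. *)
Lemma card_index_line_ge t : (N <= #|index_line t|)%N.
Proof.
suff [f f_inj fE] : exists2 f : 'I_N -> index, injective f & forall i, f i \in index_line t.
  rewrite -{1}(card_ord N) -(card_imset _ f_inj); apply: subset_leq_card.
  by apply/fintype.subsetP => _ /imsetP[i _ ->].
case: t => [[[c|c]|k]|[]].
- by exists (fun j => (c, j)) => [i j []|i] //; rewrite inE /=.
- by exists (fun i => (i, c)) => [i j []|i] //; rewrite inE /=.
- exists (fun i : 'I_N => (i, ord_of (k + (N - i)))) => [i j []|i] //; rewrite inE /=.
  rewrite modnDmr addnCA subnKC ?modnDr //; exact: ltnW.
- by exists (fun i => (i, i)) => [i j []|i] //; rewrite inE /=.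
Qed.

Definition configuration : {fset R * R} := [fset cfg_point x | x in {: index}]%fset.

Lemma card_configuration : #|` configuration| = (N ^ 2)%N.
Proof.
by rewrite card_imfset ?[size _]/= -?cardE ?card_prod ?card_ord //; exact: cfg_point_inj.
Qed.

(** If two points of L share the first index x.1, they both lie on the even
    line of x.1, which is therefore L; on that line the first index is constant,
    so the second one is injective. *)
Lemma incidence_configuration_le L : is_line L -> (incidence configuration L <= N)%N.
Proof.
move=> lL; rewrite (incidence_image _ cfg_point_inj).
set A := [set x | _]%SET; have inA x : (x \in A) = (cfg_point x \in L) by rewrite finset.in_set.
suff [f f_inj] : exists f : index -> 'I_N, {in A &, injective f}.
  by rewrite -(card_in_imset f_inj) -[X in (_ <= X)%N](card_ord N) max_card.
have [fst_inj|] := pselect {in A &, injective (fun x : index => x.1)}; first by exists fst.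
move=> nfst; have [x [y [xA yA xy1 xy]]] : exists x y, [/\ x \in A, y \in A, x.1 = y.1 & x != y].
  apply: contrapT => nE; apply: nfst => x y xA yA xy1; apply/eqP/negPn/negP => xy.
  by apply: nE; exists x, y.
have Lx : L = rich_line (inl (inl (inl x.1))).
  have Pxy : cfg_point x != cfg_point y by rewrite (inj_eq cfg_point_inj).
  rewrite (is_line_through lL Pxy); [|by rewrite -inA|by rewrite -inA].
  apply/esym/is_line_through; [exact: is_line_rich|by []|..].
    by rewrite cfg_point_rich_line inE.
  by rewrite cfg_point_rich_line inE xy1.
exists snd => -[z1 z2] [w1 w2]; rewrite !inA Lx !cfg_point_rich_line !inE /=.
by move=> /eqP-> /eqP-> ->.
Qed.

Lemma incidence_rich_line t : incidence configuration (rich_line t) = N.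
Proof.
apply/eqP; rewrite eqn_leq incidence_configuration_le; last exact: is_line_rich.
rewrite (incidence_image _ cfg_point_inj); apply: leq_trans (card_index_line_ge t) _.
apply: subset_leq_card; apply/fintype.subsetP => x.
by rewrite finset.in_set cfg_point_rich_line.
Qed.

(** For lines of different kinds, one of which is even or odd, two points of the
    latter that differ only in their free index, equal to 0 or 1, cannot both lie
    on the other line.  A direction line containing the points (0, 0) and (1, 1)
    of the center line would make 0 and 2 congruent modulo N, against N >= 3. *)
Lemma index_line_inj : injective index_line.
Proof.
have n10 : (ord_of 1 == ord_of 0) = false.
  by rewrite -val_eqE /= !modn_small //; exact: ltnW.
pose kind (t : rich_index) := match t with
  inl (inl (inl _)) => 0 | inl (inl (inr _)) => 1 | inl (inr _) => 2 | inr _ => 3 end%N.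
move=> s t; wlog : s t / (kind s <= kind t)%N.
  by move=> wl E; case/orP: (leq_total (kind s) (kind t)) => /wl ->.
case: s => [[[c|c]|k]|[]]; case: t => [[[d|d]|l]|[]] // _ /setP E.
- by have := E (c, c); rewrite !inE /= eqxx => /esym/eqP ->.
- have := E (c, ord_of 0); have := E (c, ord_of 1); rewrite !inE /= eqxx.
  by move=> /esym/eqP<- /esym; rewrite eq_sym n10.
- have := E (c, ord_of 0); have := E (c, ord_of 1); rewrite !inE /= eqxx.
  move=> /esym/eqP <- /esym; rewrite eqn_modDl !modn_mod.
  by move: n10; rewrite -val_eqE /= eq_sym => ->.
- have := E (c, ord_of 0); have := E (c, ord_of 1); rewrite !inE /= eqxx.
  by move=> /esym/eqP-> /esym; rewrite n10.
- by have := E (c, c); rewrite !inE /= eqxx => /esym/eqP ->.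
- have := E (ord_of 0, c); have := E (ord_of 1, c); rewrite !inE /= eqxx.
  move=> /esym/eqP <- /esym; rewrite eqn_modDr !modn_mod.
  by move: n10; rewrite -val_eqE /= eq_sym => ->.
- have := E (ord_of 0, c); have := E (ord_of 1, c); rewrite !inE /= eqxx.
  by move=> /esym/eqP<- /esym; rewrite eq_sym n10.
- have := E (k, ord_of 0); rewrite !inE /= mod0n addn0 eqxx => /esym.
  by rewrite !modn_small // => /eqP/val_inj ->.
- have := E (ord_of 0, ord_of 0); have := E (ord_of 1, ord_of 1).
  rewrite !inE /= !eqxx => /eqP <-; rewrite mod0n addn0 mod0n.
  by rewrite !modn_small //; exact: ltnW.
Qed.

Lemma rich_line_inj : injective rich_line.
Proof.
move=> t t' E; apply: index_line_inj; apply/setP => x.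
by rewrite -!cfg_point_rich_line E.
Qed.

Lemma tk_configuration_ge : (3 * N + 1 <= tk N configuration)%N.
Proof.
apply: (@leq_trans #|` [fset rich_line t | t in {: rich_index}]%fset|).
  rewrite card_imfset /=; last exact: rich_line_inj.
  by rewrite -cardE !card_sum !card_ord card_unit; lia.
apply: fsubset_leq_card; apply/fsubsetP => _ /imfsetP[t _ ->].
rewrite in_fset_set; last by apply: finite_lines_meeting; exact: ltnW.
by rewrite inE; split; [exact: is_line_rich|exact: incidence_rich_line].
Qed.

End Construction.

Theorem mainTheorem4 (R : realType) (N : nat) (hodd : odd N) (hN : (5 <= N)%N) :
  (3 * N + 1 <= tmax R N N.+1 (N ^ 2))%N /\
  exists S : {fset R * R},
    [/\ #|` S|%fset = (N ^ 2)%N,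
        forall L : set (R * R), is_line L -> (incidence S L <= N)%N
      & (3 * N + 1 <= tk N S)%N].
Proof.
have N3 : (3 <= N)%N by apply: ltnW; apply: ltnW.
have card_S := card_configuration R hodd N3.
have inc_S := @incidence_configuration_le R N hodd N3.
have tk_S := @tk_configuration_ge R N hodd N3.
split; last by exists (configuration R N).
apply: leq_trans tk_S _; apply: tk_le_tmax card_S _ => //.
exact: ltnW.
Qed.
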